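(* Let $A$ be a commutative unital C*-algebra, let $\theta : A \to M_n(\mathbb{C})$ be a continuous unital homomorphism, and let $\alpha : A \to A$ be a unital antilinear contraction. Define $$\theta_\alpha(f) := \tfrac12\bigl(\theta(f)+\theta(\alpha(f))^*\bigr)\quad (f\in A).$$ If $\|\theta_\alpha\|\le 1$, then $\theta$ is a $*$-homomorphism, and in particular $\|\theta\|=1$.
   Context: $M_n(\mathbb{C})$ carries the operator norm. A map $\alpha$ is antilinear if $\alpha(\lambda f+g)=\overline\lambda\alpha(f)+\alpha(g)$. It is a contraction if $\|\alpha(f)\|\le\|f\|$, and it is unital if $\alpha(1)=1$. *)

(* Defs.v *)
From HB Require Import structures.
From mathcomp Require Import all_boot all_order all_algebra.
From mathcomp Require Import classical_sets reals.
From mathcomp Require Export complex.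
Set Implicit Arguments. Unset Strict Implicit. Unset Printing Implicit Defensive.
Import Order.TTheory GRing.Theory Num.Theory.
Local Open Scope ring_scope.

Section Defs.
Variable R : realType.
Local Notation C := R[i].

Definition cabs (z : C) : R := Normc.normc z.

Definition cauchy_seq (A : comAlgType C) (nrm : A -> R) (u : nat -> A) :=
  forall e : R, 0 < e -> exists N : nat, forall m k : nat,
    (N <= m)%N -> (N <= k)%N -> nrm (u m - u k) < e.

Definition converges_to (A : comAlgType C) (nrm : A -> R) (u : nat -> A) (l : A) :=
  forall e : R, 0 < e -> exists N : nat, forall m : nat,
    (N <= m)%N -> nrm (u m - l) < e.

Definition is_comm_unital_Cstar_algebra (A : comAlgType C)
    (nrm : A -> R) (star : A -> A) : Prop :=
  [/\
      (forall x : A, nrm x = 0 -> x = 0),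
      (forall (l : C) (x : A), nrm (l *: x) = cabs l * nrm x),
      (forall x y : A, nrm (x + y) <= nrm x + nrm y),
      (forall x y : A, nrm (x * y) <= nrm x * nrm y) &
      (forall u : nat -> A, cauchy_seq nrm u -> exists l, converges_to nrm u l)] /\
      [/\ forall (l : C) (x y : A), star (l *: x + y) = conjc l *: star x + star y,
          forall x y : A, star (x * y) = star y * star x,
          forall x : A, star (star x) = x
        &
          forall x : A, nrm (star x * x) = nrm x ^+ 2 ].

Definition vnorm (n : nat) (v : 'cV[C]_n) : R :=
  Num.sqrt (\sum_(i < n) cabs (v i ord0) ^+ 2).

Definition mxnorm (n : nat) (M : 'M[C]_n) : R :=
  sup [set vnorm (M *m v) | v in [set v : 'cV[C]_n | vnorm v <= 1]]%classic.

Definition adjmx (n : nat) (M : 'M[C]_n) : 'M[C]_n := map_mx conjc M^T.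

Definition is_unital_hom (A : comAlgType C) (n : nat) (th : A -> 'M[C]_n) :=
  [/\ forall (l : C) (f g : A), th (l *: f + g) = l *: th f + th g,
      forall f g : A, th (f * g) = th f *m th g
    & th 1 = 1%:M].

Definition continuous_map (A : comAlgType C) (nrm : A -> R) (n : nat)
    (th : A -> 'M[C]_n) :=
  forall (f : A) (e : R), 0 < e -> exists2 d : R, 0 < d &
    forall g : A, nrm (g - f) < d -> mxnorm (th g - th f) < e.

Definition is_star_hom (A : comAlgType C) (star : A -> A) (n : nat)
    (th : A -> 'M[C]_n) :=
  is_unital_hom th /\ forall f : A, th (star f) = adjmx (th f).

Definition map_norm (A : comAlgType C) (nrm : A -> R) (n : nat)
    (T : A -> 'M[C]_n) : R :=
  sup [set mxnorm (T f) | f in [set f : A | nrm f <= 1]]%classic.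

Definition antilinear (A : comAlgType C) (al : A -> A) :=
  forall (l : C) (f g : A), al (l *: f + g) = conjc l *: al f + al g.

Definition theta_alpha (A : comAlgType C) (n : nat) (th : A -> 'M[C]_n)
    (al : A -> A) (f : A) : 'M[C]_n :=
  2^-1 *: (th f + adjmx (th (al f))).

End Defs.

(* Main.v *)
Require Import Defs.
From mathcomp Require Import all_boot all_order all_algebra.
From mathcomp Require Import classical_sets boolp reals complex.
From mathcomp Require Import ring lra.
Set Implicit Arguments. Unset Strict Implicit. Unset Printing Implicit Defensive.
Import Order.TTheory GRing.Theory Num.Theory.
Local Open Scope ring_scope.

(* Everything reduces to finite dimensions without Gelfand theory. For self-adjoint
   [h] the eigenvalues of [th h] are real and [th h] has no nilpotent part, because
   the norms of the powers of [1 + i s h] grow too slowly; hence [th] is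
   simultaneously diagonalizable and [th f = sum_i chi_i(f) Q_i] for characters
   [chi_i] of [A]. A unital contractive functional is positive on squares, which
   applies to [f |-> <th_al(f) v, v>] and to [f |-> conj (chi_i (al f))]. Evaluating
   [th_al] on positive elements that interpolate indicators of sets of characters
   shows that [th f + th(al f)^*] is a positive matrix with an idempotent summand,
   which forces every [Q_i] to be self-adjoint. *)

(** * Powers, moduli and norms *)

(** Since [al] need be neither multiplicative nor compatible with [star], [chi_i (al f)] need not be
    a character of [f], and only its positivity on squares can be exploited. This dictates the test
    elements: [e] must be the square of a self-adjoint element, so that [sym e] is positive and the
    values of [al e] are nonnegative, and [1 - e] must be one too, so that those values are at most
    1. The rational parametrization of the circle gives both at once; it costs the inverse of
    [1 + b^2], which a Neumann series provides. No exponential or functional calculus is used: for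
    skew [x] the product of [1 + x + x^2/2] with its adjoint is [1 + x^4/4], and the resulting norm
    bound suffices both for the inverse and for positivity. Continuity of [th] gives a bound with an
    unknown constant only; applying it to high powers and taking roots removes the constant. *)

Section RealPowers.
Variable R : realType.
Implicit Types x y a c u : R.

Lemma exp_bernoulli u k : 0 <= u -> 1 + k%:R * u <= (1 + u) ^+ k.
Proof.
move=> u0; elim: k => [|k IH]; first by rewrite mul0r addr0 expr0.
rewrite exprS -natr1; have k0 : 0 <= k%:R :> R by rewrite ler0n.
apply: le_trans (_ : (1 + u) * (1 + k%:R * u) <= _); first by nra.
by rewrite ler_wpM2l // addr_ge0.
Qed.

Lemma exp_le_double u k : 0 <= u -> 2 * k%:R * u <= 1 -> (1 + u) ^+ k <= 2.
Proof.
move=> u0 ku; have k0 : 0 <= k%:R :> R by rewrite ler0n.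
(* The constant 2 is not preserved by the induction; this linear bound is, because
   [2 * k * u * u <= u]. *)
suff H : (1 + u) ^+ k <= 1 + 2 * k%:R * u by lra.
elim: k ku k0 => [|k IH]; first by rewrite expr0 mulr0 mul0r addr0.
rewrite exprS -natr1 => ku k0'; have k0 : 0 <= k%:R :> R by rewrite ler0n.
have /IH/(_ k0) {}IH : 2 * k%:R * u <= 1 by nra.
apply: le_trans (_ : (1 + u) * (1 + 2 * k%:R * u) <= _).
  by rewrite ler_wpM2l // addr_ge0.
by nra.
Qed.

Lemma exp_unbounded a c : 1 < a -> exists k, c < a ^+ k.
Proof.
move=> a1; pose k := Num.bound `|c / (a - 1)|; exists k.
have a0 : 0 < a - 1 by rewrite subr_gt0.
have : c / (a - 1) < k%:R.
  by apply: le_lt_trans (ler_norm _) _; apply: archi_boundP; apply: normr_ge0.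
rewrite ltr_pdivrMr // => ck; have := exp_bernoulli k (ltW a0).
by rewrite [1 + (a - 1)]addrC subrK; lra.
Qed.

(** The constant [c] disappears on taking [m]-th roots. Arbitrarily large exponents suffice, so
    powers of two may be used. *)
Lemma le_of_exp_le x y c : 0 <= x -> 0 <= y ->
  (forall k, exists2 m, (k <= m)%N & x ^+ m <= c * y ^+ m) -> x <= y.
Proof.
move=> x0 y0 H; rewrite leNgt; apply/negP => yx.
have [y_eq0|y_neq0] := eqVneq y 0.
  have [m m1] := H 1%N; rewrite y_eq0 expr0n.
  case: m m1 => // m _; rewrite mulr0 leNgt => /negP; apply.
  by rewrite exprn_gt0 // -y_eq0.
have yp : 0 < y by rewrite lt_def y_neq0.
have r1 : 1 < x / y by rewrite ltr_pdivlMr // mul1r.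
have [k ck] := exp_unbounded c r1; have [m km] := H k.
rewrite -ler_pdivrMr ?exprn_gt0 // -expr_div_n => xm.
have : (x / y) ^+ k <= (x / y) ^+ m by rewrite ler_weXn2l // ltW.
by rewrite leNgt (le_lt_trans xm ck).
Qed.

Lemma exp_small x c : 0 <= x < 1 -> 0 < c -> exists k, x ^+ k < c.
Proof.
move=> /andP[x0 x1] c0; have [->|xn] := eqVneq x 0.
  by exists 1%N; rewrite expr1.
have xp : 0 < x by rewrite lt_def xn.
have r1 : 1 < x^-1 by rewrite invf_gt1.
have [k kP] := exp_unbounded c^-1 r1; exists k.
by move: kP; rewrite exprVn ltf_pV2 // posrE exprn_gt0.
Qed.

End RealPowers.

Section Modulus.
Variable R : realType.
Local Notation C := R[i].
Implicit Types z w : C.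

Lemma cabs_ge0 z : 0 <= cabs z.
Proof. by case: z => a b; apply: sqrtr_ge0. Qed.

Lemma cabs0 : cabs (0 : C) = 0.
Proof. exact: Normc.normc0. Qed.

Lemma cabs1 : cabs (1 : C) = 1.
Proof. exact: Normc.normc1. Qed.

Lemma cabs_eq0 z : cabs z = 0 -> z = 0.
Proof. exact: Normc.eq0_normc. Qed.

Lemma cabsM z w : cabs (z * w) = cabs z * cabs w.
Proof. exact: Normc.normcM. Qed.

Lemma cabsX z k : cabs (z ^+ k) = cabs z ^+ k.
Proof. by elim: k => [|k IH]; rewrite ?cabs1 // !exprS cabsM IH. Qed.

Lemma cabsD z w : cabs (z + w) <= cabs z + cabs w.
Proof. exact: le_normcD. Qed.

Lemma cabsN z : cabs (- z) = cabs z.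
Proof. by case: z => a b; rewrite /cabs /= !sqrrN. Qed.

Lemma cabsJ z : cabs (conjc z) = cabs z.
Proof. by case: z => a b; rewrite /cabs /= sqrrN. Qed.

Lemma cabs_real (a : R) : cabs (a%:C)%C = `|a|.
Proof. by rewrite /cabs /= expr0n addr0 sqrtr_sqr. Qed.

Lemma cabs_sqr z : cabs z ^+ 2 = complex.Re z ^+ 2 + complex.Im z ^+ 2.
Proof. by case: z => a b; rewrite /cabs /= sqr_sqrtr // addr_ge0 ?sqr_ge0. Qed.

Lemma cabs_sqrJ z : ((cabs z ^+ 2)%:C)%C = conjc z * z.
Proof. by rewrite cabs_sqr add_Re2_Im2 sqr_normc mulrC. Qed.

Lemma cabs_sum (I : Type) (r : seq I) (P : pred I) (F : I -> C) :
  cabs (\sum_(i <- r | P i) F i) <= \sum_(i <- r | P i) cabs (F i).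
Proof.
elim/big_ind2: _ => //; first by rewrite cabs0.
by move=> x a y b xa yb; apply: le_trans (cabsD _ _) (lerD xa yb).
Qed.

End Modulus.

Section Norms.
Variable R : realType.
Local Notation C := R[i].

Section Fixed.
Variable n : nat.
Implicit Types (v w : 'cV[C]_n) (M : 'M[C]_n).

Lemma vnorm_ge0 v : 0 <= vnorm v.
Proof. exact: sqrtr_ge0. Qed.

Lemma vnorm_sqr v : vnorm v ^+ 2 = \sum_(i < n) cabs (v i ord0) ^+ 2.
Proof. by rewrite sqr_sqrtr // sumr_ge0 // => i _; rewrite sqr_ge0. Qed.

Lemma vnormZ (l : C) v : vnorm (l *: v) = cabs l * vnorm v.
Proof.
apply/eqP; rewrite -(@eqrXn2 _ 2) ?mulr_ge0 ?vnorm_ge0 ?cabs_ge0 //.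
rewrite exprMn !vnorm_sqr mulr_sumr; apply/eqP/eq_bigr => i _.
by rewrite mxE cabsM exprMn.
Qed.

Lemma cabs_le_vnorm v i : cabs (v i ord0) <= vnorm v.
Proof.
rewrite -(@ler_pXn2r _ 2) ?nnegrE ?vnorm_ge0 ?cabs_ge0 // vnorm_sqr.
by rewrite (bigD1 i) //= lerDl sumr_ge0 // => j _; rewrite sqr_ge0.
Qed.

Lemma vnorm0_eq0 v : vnorm v = 0 -> v = 0.
Proof.
move=> v0; apply/colP => i; rewrite mxE; apply: cabs_eq0.
by apply/eqP; rewrite eq_le cabs_ge0 andbT -v0 cabs_le_vnorm.
Qed.

Lemma vnorm0 : vnorm (0 : 'cV[C]_n) = 0.
Proof. by rewrite -(scale0r (0 : 'cV[C]_n)) vnormZ cabs0 mul0r. Qed.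

Lemma vnorm_delta i : vnorm (delta_mx i ord0 : 'cV[C]_n) = 1.
Proof.
rewrite /vnorm (bigD1 i) //= mxE !eqxx cabs1 expr1n big1 ?addr0 ?sqrtr1 //.
by move=> j /negPf ji; rewrite mxE ji cabs0 expr0n.
Qed.

Lemma vnorm_le_entries v (B : R) : 0 <= B ->
  (forall i, cabs (v i ord0) <= B) -> vnorm v <= n%:R * B.
Proof.
move=> B0 vB; have nB : 0 <= n%:R * B by rewrite mulr_ge0 ?ler0n.
rewrite -(@ler_pXn2r _ 2) ?nnegrE ?vnorm_ge0 // vnorm_sqr.
apply: le_trans (_ : \sum_(i < n) B ^+ 2 <= _).
  by apply: ler_sum => i _; rewrite lerXn2r ?nnegrE ?cabs_ge0.
rewrite sumr_const card_ord -(mulr_natl (B ^+ 2)) exprMn; apply: ler_wpM2r; first exact: sqr_ge0.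
by rewrite -natrX ler_nat; case: (n) => // m; apply: leq_pmulr.
Qed.

(** The factor [n^2] is crude on purpose: it serves only to show boundedness, or is removed later by
    taking roots. *)
Lemma vnorm_mulmx_le M (B : R) v : 0 <= B -> (forall i j, cabs (M i j) <= B) ->
  vnorm (M *m v) <= n%:R * (n%:R * B) * vnorm v.
Proof.
move=> B0 MB; rewrite -!mulrA; apply: vnorm_le_entries => [|i].
  by rewrite !mulr_ge0 ?vnorm_ge0 ?ler0n.
rewrite mxE; apply: le_trans (cabs_sum _ _ _) _.
apply: le_trans (_ : \sum_(j < n) B * vnorm v <= _).
  by apply: ler_sum => j _; rewrite cabsM ler_pM ?cabs_ge0 ?cabs_le_vnorm.
by rewrite sumr_const card_ord mulr_natl.
Qed.

(** The supremum in [mxnorm] dominates its elements only because of this bound. *)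
Lemma has_ubound_mxnorm M :
  has_ubound [set vnorm (M *m v) | v in [set v : 'cV[C]_n | vnorm v <= 1]]%classic.
Proof.
pose B := \sum_i \sum_j cabs (M i j).
have MB i j : cabs (M i j) <= B.
  rewrite /B (bigD1 i) //= (bigD1 j) //= -addrA lerDl addr_ge0 //.
    by apply: sumr_ge0 => *; apply: cabs_ge0.
  by do 2![apply: sumr_ge0 => ? _]; apply: cabs_ge0.
have B0 : 0 <= B by do 2![apply: sumr_ge0 => ? _]; apply: cabs_ge0.
exists (n%:R * (n%:R * B)) => _ [v /= v1 <-].
apply: le_trans (vnorm_mulmx_le v B0 MB) _.
by rewrite ler_piMr // !mulr_ge0 ?ler0n.
Qed.

Lemma vnorm_le_mxnorm M v : vnorm v <= 1 -> vnorm (M *m v) <= mxnorm M.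
Proof. by move=> v1; apply: ub_le_sup; [exact: has_ubound_mxnorm | exists v]. Qed.

Lemma mxnorm_le M (c : R) : (forall v, vnorm v <= 1 -> vnorm (M *m v) <= c) ->
  mxnorm M <= c.
Proof.
move=> Mc; apply: ge_sup; last by move=> _ [v /= v1 <-]; apply: Mc.
by exists (vnorm (M *m 0)); exists 0; rewrite //= vnorm0.
Qed.

Lemma cabs_le_mxnorm M i j : cabs (M i j) <= mxnorm M.
Proof.
have := vnorm_le_mxnorm M (_ : vnorm (delta_mx j ord0) <= 1).
rewrite vnorm_delta lexx => /(_ isT); apply: le_trans.
by rewrite -colE; apply: le_trans (cabs_le_vnorm _ i); rewrite mxE.
Qed.

Lemma mxnorm_le_entries M (B : R) : 0 <= B -> (forall i j, cabs (M i j) <= B) ->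
  mxnorm M <= n%:R * (n%:R * B).
Proof.
move=> B0 MB; apply: mxnorm_le => v v1; apply: le_trans (vnorm_mulmx_le v B0 MB) _.
by rewrite ler_piMr // !mulr_ge0 ?ler0n.
Qed.

End Fixed.

Variables (A : comAlgType C) (nrm : A -> R) (n : nat) (T : A -> 'M[C]_n).

Lemma mxnorm_le_map_norm (B : R) :
  (forall f, nrm f <= 1 -> mxnorm (T f) <= B) ->
  forall f, nrm f <= 1 -> mxnorm (T f) <= map_norm nrm T.
Proof.
move=> TB f f1; apply: ub_le_sup; last by exists f.
by exists B => _ [g /= g1 <-]; apply: TB.
Qed.

End Norms.

(** * Commutative C*-algebras *)

Section CstarAlgebra.
Variable R : realType.
Local Notation C := R[i].
Variables (A : comAlgType C) (nrm : A -> R) (star : A -> A).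
Hypothesis HA : is_comm_unital_Cstar_algebra nrm star.
Implicit Types (x y h f : A) (l : C).

Lemma nrm_eq0 x : nrm x = 0 -> x = 0.
Proof. by case: HA => -[H _ _ _ _] _; apply: H. Qed.

Lemma nrmZ l x : nrm (l *: x) = cabs l * nrm x.
Proof. by case: HA => -[_ H _ _ _] _; apply: H. Qed.

Lemma nrmD x y : nrm (x + y) <= nrm x + nrm y.
Proof. by case: HA => -[_ _ H _ _] _; apply: H. Qed.

Lemma nrmM x y : nrm (x * y) <= nrm x * nrm y.
Proof. by case: HA => -[_ _ _ H _] _; apply: H. Qed.

Lemma starP l x y : star (l *: x + y) = conjc l *: star x + star y.
Proof. by case: HA => _ [H _ _ _]; apply: H. Qed.

Lemma starM x y : star (x * y) = star x * star y.
Proof. by case: HA => _ [_ H _ _]; rewrite H mulrC. Qed.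

Lemma starK x : star (star x) = x.
Proof. by case: HA => _ [_ _ H _]; apply: H. Qed.

Lemma nrm_starM x : nrm (star x * x) = nrm x ^+ 2.
Proof. by case: HA => _ [_ _ _ H]; apply: H. Qed.

Lemma nrm0 : nrm 0 = 0.
Proof. by rewrite -(scale0r (0 : A)) nrmZ cabs0 mul0r. Qed.

Lemma nrmN x : nrm (- x) = nrm x.
Proof. by rewrite -scaleN1r nrmZ cabsN cabs1 mul1r. Qed.

Lemma nrm_ge0 x : 0 <= nrm x.
Proof. by have := nrmD x (- x); rewrite subrr nrm0 nrmN; lra. Qed.

Lemma starD x y : star (x + y) = star x + star y.
Proof.
have c1 : conjc (1 : C) = 1 := conjc1 R.
by have := starP 1 x y; rewrite c1 !scale1r.
Qed.

Lemma star0 : star 0 = 0.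
Proof. by apply: (addrI (star 0)); rewrite -starD !addr0. Qed.

Lemma starZ l x : star (l *: x) = conjc l *: star x.
Proof. by have := starP l x 0; rewrite star0 !addr0. Qed.

Lemma starN x : star (- x) = - star x.
Proof. by apply: (addrI (star x)); rewrite -starD !subrr star0. Qed.

Lemma star1 : star 1 = 1.
Proof. by rewrite -[LHS]mulr1 -{2}(starK 1) -starM mul1r starK. Qed.

Lemma starX x k : star (x ^+ k) = star x ^+ k.
Proof. by elim: k => [|k IH]; rewrite ?star1 // !exprS starM IH. Qed.

Lemma star_alg l : star l%:A = (conjc l)%:A.
Proof. by rewrite starZ star1. Qed.

Lemma star_prod (I : Type) (r : seq I) (P : pred I) (F : I -> A) :
  (forall i, P i -> star (F i) = F i) ->
  star (\prod_(i <- r | P i) F i) = \prod_(i <- r | P i) F i.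
Proof.
move=> H; elim/big_ind: _ => //; first exact: star1.
by move=> x y hx hy; rewrite starM hx hy.
Qed.

Lemma nrm1_le1 : nrm 1 <= 1.
Proof.
have := nrm_starM 1; rewrite star1 mulr1 => H.
have := nrm_ge0 1; nra.
Qed.

Lemma nrm_star x : nrm (star x) = nrm x.
Proof.
suff H y : nrm y <= nrm (star y).
  by apply/eqP; rewrite eq_le H andbT -{2}(starK x) H.
have := nrm_starM y; have := nrmM (star y) y.
have := nrm_ge0 y; have := nrm_ge0 (star y); nra.
Qed.

Lemma nrmX x k : nrm (x ^+ k) <= nrm x ^+ k.
Proof.
elim: k => [|k IH]; first by rewrite !expr0 nrm1_le1.
by rewrite !exprS; apply: le_trans (nrmM _ _) _; rewrite ler_wpM2l ?nrm_ge0.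
Qed.

Lemma nrm_alg l : nrm l%:A <= cabs l.
Proof. by rewrite nrmZ ler_piMr ?cabs_ge0 ?nrm1_le1. Qed.

(** * Neumann series *)

Section Neumann.
Variable x : A.
Hypothesis x1 : nrm x < 1.
Let q := nrm x.
Let u m : A := \sum_(i < m) x ^+ i.

Let q01 : 0 <= q < 1. Proof. by rewrite nrm_ge0. Qed.

Let u_incr k d : (1 - q) * nrm (u (k + d) - u k) <= q ^+ k.
Proof.
have /andP[q0 q1] := q01.
(* The telescoping form of the geometric bound is the one that passes through the induction on
   [d]. *)
suff H : (1 - q) * nrm (u (k + d) - u k) <= q ^+ k - q ^+ (k + d).
  by apply: le_trans H _; rewrite gerBl exprn_ge0.
elim: d => [|d IH]; first by rewrite addn0 !subrr nrm0 mulr0.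
have -> : u (k + d.+1) - u k = (u (k + d) - u k) + x ^+ (k + d).
  by rewrite addnS /u big_ord_recr /= addrAC.
have := nrmD (u (k + d) - u k) (x ^+ (k + d)); have := nrmX x (k + d).
rewrite -/q addnS [q ^+ (k + d).+1]exprS.
have := exprn_ge0 (k + d) q0; nra.
Qed.

Let u_cauchy : cauchy_seq nrm u.
Proof.
have /andP[q0 q1] := q01; have p0 : 0 < 1 - q by rewrite subr_gt0.
move=> e e0; have [N qN] := exp_small q01 (mulr_gt0 e0 p0).
have main m k : (N <= k)%N -> (k <= m)%N -> nrm (u m - u k) < e.
  move=> Nk km; rewrite -(ltr_pM2l p0) (mulrC _ e); apply: le_lt_trans qN.
  rewrite -(subnKC km); apply: le_trans (u_incr _ _) _.
  by rewrite ler_wiXn2l // ltW.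
exists N => m k Nm Nk; have [km|/ltnW mk] := leqP k m; first exact: main.
by rewrite -nrmN opprB; apply: main.
Qed.

Lemma neumann_inverse : exists y, y * (1 - x) = 1.
Proof.
have [z ul] : exists z, converges_to nrm u z.
  by case: HA => -[_ _ _ _ H] _; apply: H u_cauchy.
exists z; apply/eqP; rewrite -subr_eq0; apply/eqP/nrm_eq0/eqP.
rewrite eq_le nrm_ge0 andbT leNgt; apply/negP => e0.
(* As [nrm (1 - x) < 2], the errors from [u m - z] and from [x ^+ m] add up to less than
   [2 * (e / 4) + e / 4 < e]. *)
set e := nrm _ in e0; have e4 : 0 < e / 4 by lra.
have [N lN] := ul _ e4; have [M qM] := exp_small q01 e4.
have ux m : u m * (1 - x) = 1 - x ^+ m.
  rewrite /u; elim: m => [|m IH]; first by rewrite big_ord0 mul0r expr0 subrr.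
  rewrite big_ord_recr /= mulrDl IH exprS; ring.
pose m := maxn N M; have := lN m (leq_maxl _ _).
have /andP[q0 q1] := q01.
have qm : q ^+ m <= q ^+ M by rewrite ler_wiXn2l ?leq_maxr // ltW.
have := nrmX x m; rewrite -/q.
have : e <= nrm (u m - z) * nrm (1 - x) + nrm (x ^+ m).
  have -> : e = nrm ((u m - z) * (1 - x) + x ^+ m).
    rewrite /e -nrmN; congr nrm; rewrite mulrBl ux; ring.
  by apply: le_trans (nrmD _ _) _; rewrite lerD2r nrmM.
have := nrmD 1 (- x); rewrite nrmN -/q; have := nrm1_le1.
have := nrm_ge0 (u m - z); nra.
Qed.

End Neumann.

(** * Truncated exponentials and inverses *)

Let half : C := (2^-1)%:C%C.

Let half2 : half + half = 1.
Proof. by apply/eqP; rewrite eq_complex /= addr0 eqxx andbT; apply/eqP; lra. Qed.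

(* [1 + x + x^2/2] approximates the unitary [exp x] to fourth order. *)
Lemma nrm_exp_skew_le x : star x = - x ->
  nrm (1 + x + half *: (x * x)) ^+ 2 <= 1 + nrm (x ^+ 4) / 4.
Proof.
move=> sx; rewrite -nrm_starM !starD star1 starZ starM sx /half conjc_real -/half.
have hA : half%:A + half%:A = 1 :> A by rewrite -scalerDl half2 scale1r.
rewrite mulrNN -mulr_algl; set k := half%:A in hA *.
have -> : (1 + - x + k * (x * x)) * (1 + x + k * (x * x)) =
  1 + (k + k - 1) * x ^+ 2 + k * k * x ^+ 4 by ring.
rewrite hA subrr mul0r addr0; apply: le_trans (nrmD _ _) _.
apply: lerD nrm1_le1 _; rewrite -mulrA !mulr_algl !nrmZ /half cabs_real ger0_norm; last by lra.
by have := nrm_ge0 (x ^+ 4); lra.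
Qed.

Let skew h (s : R) : A := (0 +i* s)%C *: h.

Let star_skew h s : star h = h -> star (skew h s) = - skew h s.
Proof.
by move=> sh; rewrite /skew starZ sh -scaleNr; congr (_ *: _); simpc.
Qed.

Let half_skew_sqr h s :
  half *: (skew h s * skew h s) = - ((s ^+ 2 / 2)%:C)%C *: (h * h).
Proof.
rewrite /skew -scalerAl -scalerAr !scalerA; congr (_ *: _).
apply/eqP; rewrite eq_complex /=.
by rewrite !(mul0r, mulr0, add0r, addr0, sub0r, subr0, oppr0) eqxx andbT; apply/eqP; ring.
Qed.

Let nrm_skew4 h s : nrm (skew h s ^+ 4) = s ^+ 4 * nrm (h ^+ 4).
Proof.
rewrite /skew exprZn nrmZ cabsX /cabs /= expr0n add0r sqrtr_sqr.
by rewrite -normrX ger0_norm // exprn_even_ge0.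
Qed.

(** This second-order Taylor polynomial of the cosine of [s h] is the self-adjoint part of the
    truncated exponential of [skew h s], and taking self-adjoint parts does not increase the
    norm. *)
Lemma nrm_one_sub_sqr_le h (s : R) : star h = h ->
  nrm (1 - ((s ^+ 2 / 2)%:C)%C *: (h * h)) ^+ 2 <= 1 + s ^+ 4 * nrm (h ^+ 4) / 4.
Proof.
move=> sh; have sx := star_skew s sh; rewrite -nrm_skew4.
apply: le_trans (nrm_exp_skew_le sx).
rewrite lerXn2r ?nnegrE ?nrm_ge0 // -scaleNr -half_skew_sqr.
set x := skew h s in sx *; set w := _ + _ *: _; set v := 1 + x + _.
have -> : w = half *: (v + star v).
  rewrite /v !starD star1 starZ starM sx /half conjc_real -/half mulrNN.
  rewrite /w; set y := half *: (x * x).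
  have -> : 1 + x + y + (1 - x + y) = (1 + y) + (1 + y) by ring.
  by rewrite scalerDr -scalerDl half2 scale1r.
rewrite nrmZ /half cabs_real ger0_norm; last by lra.
by have := nrmD v (star v); rewrite nrm_star; lra.
Qed.

(** Up to the factor [t], [1 + h * h] is [(1 + t) - (1 - t h^2)]. For small [t] the subtracted
    element has norm below [1 + t], so the Neumann series applies after division by [1 + t]. *)
Lemma inverse_one_add_sqr h : star h = h ->
  exists2 r, r * (1 + h * h) = 1 & star r = r.
Proof.
move=> sh; pose c := nrm (h ^+ 4); have c0 : 0 <= c by apply: nrm_ge0.
(* With [s^2 = 2 t] the bound on the squared norm is [1 + t^2 c]; since [t * c < 1] it stays below
   [1 + t], hence below [(1 + t)^2]. *)
pose t : R := (1 + c)^-1; have t0 : 0 < t by rewrite invr_gt0; lra.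
have tc : t * c < 1 by rewrite mulrC ltr_pdivrMr; lra.
pose s := Num.sqrt (2 * t).
have st : s ^+ 2 / 2 = t by rewrite sqr_sqrtr; [field | lra].
have s4 : s ^+ 4 = 4 * t ^+ 2.
  by rewrite (exprM s 2 2) sqr_sqrtr; [ring | lra].
have := nrm_one_sub_sqr_le s sh; rewrite st s4 -/c.
set y := 1 - _ => yb.
have y1 : nrm y < 1 + t by have := nrm_ge0 y; nra.
pose x := ((1 + t)^-1)%:C%C *: y.
have tp : 0 < 1 + t by lra.
have x1 : nrm x < 1.
  rewrite nrmZ cabs_real ger0_norm ?invr_ge0 ?ltW //.
  by rewrite mulrC ltr_pdivrMr // mul1r.
have [z zx] := neumann_inverse x1.
pose r := ((1 + t)^-1 * t)%:C%C *: z.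
have rh : r * (1 + h * h) = 1.
  rewrite -[RHS]zx /r -scalerAl scalerAr /x /y rmorphM /=; congr (_ * _).
  rewrite -!(mulr_algl _ (1 + _)) -!(mulr_algl _ (h * h)).
  rewrite -scalerA -mulr_algl; set K := (_ : C)%:A; set T := (_ : C)%:A.
  have KT : K * T = 1 - K.
    rewrite /K /T mulr_algl scalerA -rmorphM /= -[X in X - _]scale1r -scalerBl.
    congr (_ *: _); apply/eqP; rewrite eq_complex /= oppr0 addr0 eqxx andbT.
    by apply/eqP; field; rewrite gt_eqF.
  by rewrite mulrDr mulr1 KT mulrBr mulr1 !mulrA KT; ring.
exists r => //.
have rsh : star r * (1 + h * h) = 1.
  by have := congr1 star rh; rewrite starM starD starM star1 sh.
by rewrite -[LHS]mulr1 -{1}rh mulrCA rsh mulr1.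
Qed.

(** Arens' trick: after squaring, [t^2] cancels and the term [2 b t] remains, unbounded in [t]
    unless the imaginary part [b] is 0. A bare number [z] lets this serve eigenvalues and values of
    functionals alike. *)
Lemma real_of_imaginary_shifts h (z : C) : star h = h ->
  (forall t : R, cabs (z + (0 +i* t)%C) <= nrm (h + (0 +i* t)%C%:A)) ->
  complex.Im z = 0.
Proof.
move=> sh zh; set b := complex.Im z; set a := complex.Re z.
have key (t : R) : a ^+ 2 + (b + t) ^+ 2 <= nrm (h * h) + t ^+ 2.
  have -> : a ^+ 2 + (b + t) ^+ 2 = cabs (z + (0 +i* t)%C) ^+ 2.
    by rewrite cabs_sqr /a /b; case: (z) => a' b' /=; rewrite addr0.
  apply: le_trans (_ : nrm (h + (0 +i* t)%C%:A) ^+ 2 <= _).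
    by rewrite lerXn2r ?nnegrE ?nrm_ge0 ?cabs_ge0.
  rewrite -nrm_starM starD sh star_alg.
  have -> : conjc (0 +i* t)%C = - (0 +i* t)%C by simpc.
  rewrite scaleNr; set u := _%:A.
  have -> : (h - u) * (h + u) = h * h - u * u by ring.
  apply: le_trans (nrmD _ _) _; rewrite lerD2l nrmN.
  apply: le_trans (nrmM _ _) _.
  rewrite -(real_normK (num_real t)) expr2.
  have ut : nrm u <= `|t|.
    by apply: le_trans (nrm_alg _) _; rewrite /cabs /= expr0n add0r sqrtr_sqr.
  by rewrite ler_pM ?nrm_ge0.
apply/eqP/negPn/negP => b0.
have := key ((nrm (h * h) + 1) / (2 * b)); set N := nrm _; set t := _ / _.
have bt : 2 * b * t = N + 1 by rewrite mulrC divfK // mulf_neq0 // pnatr_eq0.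
nra.
Qed.

(** * Positivity of unital contractive functionals *)

Section UnitalContractiveFunctional.
Variable phi : A -> C.
Hypotheses (phi_lin : forall l x y, phi (l *: x + y) = l * phi x + phi y)
  (phi1 : phi 1 = 1) (phi_le : forall x, cabs (phi x) <= nrm x).

Lemma functionalD x y : phi (x + y) = phi x + phi y.
Proof. by rewrite -[x]scale1r phi_lin mul1r scale1r. Qed.

Lemma functional0 : phi 0 = 0.
Proof. by apply: (addrI (phi 0)); rewrite -functionalD !addr0. Qed.

Lemma functionalZ l x : phi (l *: x) = l * phi x.
Proof. by rewrite -[l *: x]addr0 phi_lin functional0 addr0. Qed.

Lemma functional_selfadjoint_real h : star h = h -> complex.Im (phi h) = 0.
Proof.
move=> sh; apply: (real_of_imaginary_shifts sh) => t.
by rewrite -[X in _ + X]mulr1 -phi1 -functionalZ -functionalD phi_le.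
Qed.

(** A Kadison-Schwarz inequality, and the source of all positivity here. At the truncated
    exponential with [s^2 = t], contractivity reads [(1 - t p / 2)^2 + t a^2 <= 1 + t^2 c / 4]; the
    terms linear in [t] give [a^2 <= p]. *)
Lemma functional_sqr_ge h : star h = h ->
  complex.Re (phi h) ^+ 2 <= complex.Re (phi (h * h)).
Proof.
move=> sh; have rh := functional_selfadjoint_real sh.
have shh : star (h * h) = h * h by rewrite starM sh.
have rhh := functional_selfadjoint_real shh.
set a := complex.Re (phi h); set p := complex.Re _.
have ha : phi h = (a%:C)%C by rewrite [LHS]complexE rh mulr0 addr0.
have hp : phi (h * h) = (p%:C)%C by rewrite [LHS]complexE rhh mulr0 addr0.
rewrite leNgt; apply/negP => pa.
pose c := nrm (h ^+ 4); have c0 : 0 <= c by apply: nrm_ge0.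
pose t := (a ^+ 2 - p) / (1 + c).
have t0 : 0 < t by rewrite divr_gt0 //; lra.
have tc : t * c < a ^+ 2 - p.
  have -> : a ^+ 2 - p = t * (1 + c) by rewrite divfK // gt_eqF //; lra.
  by lra.
pose s := Num.sqrt t; have st : s ^+ 2 = t by rewrite sqr_sqrtr ?ltW.
have s4 : s ^+ 4 = t ^+ 2 by rewrite (exprM s 2 2) st.
have := nrm_exp_skew_le (star_skew s sh); rewrite nrm_skew4 s4 half_skew_sqr -/c.
set w := 1 + _ + _ => wb.
have : cabs (phi w) ^+ 2 <= 1 + t ^+ 2 * c / 4.
  by apply: le_trans wb; rewrite lerXn2r ?nnegrE ?nrm_ge0 ?cabs_ge0.
rewrite /w 2!functionalD !functionalZ phi1 hp ha cabs_sqr /= st.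
rewrite !(mul0r, mulr0, add0r, addr0, sub0r, subr0, oppr0).
by rewrite exprMn st; nra.
Qed.

End UnitalContractiveFunctional.

End CstarAlgebra.

(** * Spectral theory of a continuous homomorphism *)

Section Homomorphism.
Variable R : realType.
Local Notation C := R[i].
Variables (A : comAlgType C) (nrm : A -> R) (star : A -> A).
Hypothesis HA : is_comm_unital_Cstar_algebra nrm star.
Variables (n' : nat).
Local Notation n := n'.+1.
Variable th : A -> 'M[C]_n.
Hypotheses (th_hom : is_unital_hom th) (th_cont : continuous_map nrm th).
Implicit Types (f g h : A) (l z : C).

Lemma homP l f g : th (l *: f + g) = l *: th f + th g.
Proof. by case: th_hom. Qed.

Lemma homM f g : th (f * g) = th f * th g.
Proof. by case: th_hom. Qed.

Lemma hom1 : th 1 = 1.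
Proof. by case: th_hom. Qed.

Lemma homD f g : th (f + g) = th f + th g.
Proof. by rewrite -[f]scale1r homP !scale1r. Qed.

Lemma hom0 : th 0 = 0.
Proof. by apply: (addrI (th 0)); rewrite -homD !addr0. Qed.

Lemma homZ l f : th (l *: f) = l *: th f.
Proof. by rewrite -[l *: f]addr0 homP hom0 addr0. Qed.

Lemma homN f : th (- f) = - th f.
Proof. by rewrite -scaleN1r homZ scaleN1r. Qed.

Lemma homB f g : th (f - g) = th f - th g.
Proof. by rewrite homD homN. Qed.

Lemma homX f k : th (f ^+ k) = th f ^+ k.
Proof. by elim: k => [|k IH]; rewrite ?hom1 // !exprS homM IH. Qed.

Lemma hom_bounded_entries :
  exists2 K : R, 0 <= K & forall f i j, cabs (th f i j) <= K * nrm f.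
Proof.
have [d d0 dP] := th_cont 0 ltr01.
exists (2 / d) => [|f i j]; first by rewrite divr_ge0 // ltW.
have f0 := nrm_ge0 HA f.
have [/(nrm_eq0 HA)->|fn] := eqVneq (nrm f) 0.
  by rewrite hom0 mxE cabs0 (nrm0 HA) mulr0.
have fp : 0 < nrm f by rewrite lt_def fn.
pose s := d / (2 * nrm f); have s0 : 0 < s by rewrite divr_gt0 // mulr_gt0.
have := dP (s%:C%C *: f); rewrite subr0 hom0 subr0 (nrmZ HA) cabs_real gtr0_norm //.
have -> : s * nrm f = d / 2 by rewrite /s; field.
move=> dH; have {dH} H : mxnorm (th (s%:C%C *: f)) < 1 by apply: dH; lra.
have := le_lt_trans (cabs_le_mxnorm (th (s%:C%C *: f)) i j) H.
rewrite homZ mxE cabsM cabs_real gtr0_norm // mulrC -ltr_pdivlMr // => /ltW.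
by congr (_ <= _); rewrite /s; field; rewrite fn gt_eqF.
Qed.

(** The entry bound on [th (f ^+ k)] controls [z ^+ k] up to a constant independent of [k], which
    [k]-th roots remove. *)
Lemma eigenvalue_le_nrm f z (v : 'rV[C]_n) :
  v != 0 -> v *m th f = z *: v -> cabs z <= nrm f.
Proof.
move=> v0 vf; have [K K0 thK] := hom_bounded_entries.
have vk k : v *m th (f ^+ k) = z ^+ k *: v.
  elim: k => [|k IH]; first by rewrite !expr0 hom1 mulmx1 scale1r.
  by rewrite exprS homM -[_ * _]/(_ *m _) mulmxA vf -scalemxAl IH scalerA -exprS.
have [j vj] : exists j, v ord0 j != 0.
  apply/existsP; rewrite -negb_forall; apply: contraNN v0 => /forallP H.
  by apply/eqP/rowP => j; rewrite mxE; apply/eqP; have := H j.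
have vjp : 0 < cabs (v ord0 j).
  by rewrite lt_def cabs_ge0 andbT; apply: contraNneq vj => /cabs_eq0->.
apply: (@le_of_exp_le _ _ _ ((\sum_i cabs (v ord0 i)) * K / cabs (v ord0 j))).
- exact: cabs_ge0.
- exact: nrm_ge0 HA _.
move=> k; exists k => //; rewrite mulrAC ler_pdivlMr //.
have := congr1 (fun w : 'rV[C]_n => cabs (w ord0 j)) (vk k).
rewrite /= mxE [in RHS]mxE cabsM cabsX => <-.
apply: le_trans (cabs_sum _ _ _) _; rewrite -mulrA mulr_suml; apply: ler_sum => i _.
rewrite cabsM ler_wpM2l ?cabs_ge0 //; apply: le_trans (thK _ _ _) _.
by rewrite ler_wpM2l // (nrmX HA).
Qed.

Lemma eigenvalue_selfadjoint_real h z (v : 'rV[C]_n) : star h = h ->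
  v != 0 -> v *m th h = z *: v -> complex.Im z = 0.
Proof.
move=> sh v0 vh; apply: (real_of_imaginary_shifts HA sh) => t.
apply: (eigenvalue_le_nrm v0).
by rewrite homD homZ hom1 mulmxDr vh -scalemxAr mulmx1 scalerDl.
Qed.

(* If [th g] squares to 0 then [th ((1 + i s g)^k) = 1 + i k s th g] is linear
   in [k], while the norm of [1 + i s g] is only [1 + O(s^2)]; take [s ~ k^(-1/2)]. *)
Lemma hom_selfadjoint_sqr0 g : star g = g -> th g * th g = 0 -> th g = 0.
Proof.
move=> sg g2; have [K K0 thK] := hom_bounded_entries.
apply/matrixP => a b; rewrite [RHS]mxE; apply: cabs_eq0.
set N := th g in g2 *; pose G := nrm (g * g); have G0 : 0 <= G by apply: nrm_ge0 HA _.
(* [L] makes [2 k s^2 G = 2 G / L^2] at most 1, as [exp_le_double] requires, while [k s = m.+1 / L]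
   still grows with [m]. *)
pose L := 2 * G + 1.
have key (m : nat) : m.+1%:R * cabs (N a b) <= L * (1 + 2 * K).
  pose s : R := (m.+1%:R * L)^-1.
  have m0 : 1 <= m.+1%:R :> R by rewrite ler1n.
  have L0 : 1 <= L by rewrite /L; lra.
  have mL : 0 < m.+1%:R * L by rewrite mulr_gt0 //; lra.
  have s0 : 0 < s by rewrite invr_gt0.
  pose k := (m.+1 ^ 2)%N; pose w := 1 + (0 +i* s)%C *: g.
  have kE : k%:R = m.+1%:R ^+ 2 :> R by rewrite /k natrX.
  have w2 : nrm w ^+ 2 <= 1 + s ^+ 2 * G.
    rewrite -(nrm_starM HA) (starD HA) (star1 HA) (starZ HA) sg.
    have -> : conjc (0 +i* s)%C = - (0 +i* s)%C by simpc.
    rewrite scaleNr; set x := _ *: g.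
    have -> : (1 - x) * (1 + x) = 1 - x * x by ring.
    apply: le_trans (nrmD HA _ _) _; apply: lerD (nrm1_le1 HA) _.
    rewrite (nrmN HA) /x -scalerAl -scalerAr scalerA (nrmZ HA) cabsM.
    by rewrite /cabs /= expr0n add0r sqrtr_sqr gtr0_norm // -expr2.
  have wk : (nrm w ^+ k) ^+ 2 <= 2.
    rewrite -exprM mulnC exprM; apply: le_trans (_ : (1 + s ^+ 2 * G) ^+ k <= _).
      by rewrite lerXn2r ?nnegrE ?exprn_ge0 ?(nrm_ge0 HA) // addr_ge0 // mulr_ge0 // sqr_ge0.
    apply: exp_le_double; first by rewrite mulr_ge0 // sqr_ge0.
    have -> : 2 * k%:R * (s ^+ 2 * G) = 2 * G / L ^+ 2.
      by rewrite /s kE; field; rewrite !gt_eqF //; lra.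
    by rewrite ler_pdivrMr ?exprn_gt0 //; [rewrite mul1r /L; nra|lra].
  have wk2 : nrm w ^+ k <= 2 by have := exprn_ge0 k (nrm_ge0 HA w); nra.
  have thw : th (w ^+ k) = 1 + (k%:R * (0 +i* s)%C) *: N.
    rewrite homX /w homD hom1 homZ -/N; set x := (0 +i* s)%C.
    elim: (k) => [|j IH]; first by rewrite expr0 mul0r scale0r addr0.
    rewrite exprS IH mulrDr mulr1 mulrDl mul1r -scalerAl -scalerAr g2 !scaler0 addr0.
    by rewrite -natr1 mulrDl mul1r scalerDl -addrA [x *: N + _]addrC.
  have := le_trans (thK (w ^+ k) a b) (ler_wpM2l K0 (le_trans (nrmX HA _ _) wk2)).
  rewrite thw => H.
  have : cabs ((k%:R * (0 +i* s)%C) * N a b) <= 1 + K * 2.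
    have -> : k%:R * (0 +i* s)%C * N a b =
        (1 + (k%:R * (0 +i* s)%C) *: N) a b + - ((1 : 'M_n) a b).
      by rewrite !mxE; ring.
    apply: le_trans (cabsD _ _) _; rewrite cabsN addrC; apply: lerD H.
    by rewrite mxE; case: (_ == _); rewrite ?cabs1 ?cabs0 ?ler01.
  have -> : cabs (k%:R * (0 +i* s)%C * N a b) = m.+1%:R / L * cabs (N a b).
    rewrite cabsM cabsM -(rmorph_nat (real_complex R)) cabs_real /cabs /= expr0n add0r.
    rewrite sqrtr_sqr (ger0_norm (ltW s0)) ger0_norm ?ler0n // kE /s; congr (_ * _).
    by field; rewrite !gt_eqF //; lra.
  by rewrite mulrAC ler_pdivrMr ?(mulrC 2) ?(mulrC L) // (lt_le_trans ltr01).
apply/eqP; rewrite eq_le cabs_ge0 andbT leNgt; apply/negP => N0.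
pose B := L * (1 + 2 * K) / cabs (N a b).
have := key (Num.bound `|B|); apply/negP; rewrite -ltNge -ltr_pdivrMr // -/B.
rewrite -natr1; apply: le_lt_trans (ler_norm _) _.
by apply: ltr_wpDr => //; apply: archi_boundP; apply: normr_ge0.
Qed.

Lemma hom_selfadjoint_nilpotent g k : star g = g -> th g ^+ k = 0 -> th g = 0.
Proof.
(* Raising the exponent to a power of two lets the square-zero case halve it repeatedly. *)
move=> sg gk; have {gk} : th g ^+ (2 ^ k) = 0.
  by rewrite -(subnK (ltnW (ltn_expl k (isT : (1 < 2)%N)))) exprD gk mulr0.
elim: k => [|k IH]; first by rewrite expn0 expr1.
rewrite expnS mulnC exprM expr2 -homX => /hom_selfadjoint_sqr0 H.
by apply: IH; rewrite -homX; apply: H; rewrite (starX HA) sg.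
Qed.

(** The roots of the minimal polynomial are real, so its squarefree part [q], evaluated at [h], is
    self-adjoint. Its image is nilpotent, hence zero, so [q] annihilates [th h]. *)
Lemma hom_selfadjoint_diagonalizable h : star h = h -> diagonalizable (th h).
Proof.
move=> sh; set p := mxminpoly (th h).
have [rs prs] := closed_field_poly_normal p.
have {}prs : p = \prod_(z <- rs) ('X - z%:P).
  by rewrite prs (monicP (mxminpoly_monic _)) scale1r.
pose q := \prod_(z <- undup rs) ('X - z%:P).
apply/diagonalizableP; exists (undup rs); first exact: undup_uniq.
rewrite -/q; apply: mxminpoly_min.
pose g := \prod_(z <- undup rs) (h - z%:A).
have thg : horner_mx (th h) q = th g.
  rewrite /q /g; elim: (undup rs) => [|z s IH].
    by rewrite !big_nil rmorph1 hom1.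
  rewrite !big_cons rmorphM /= IH homM; congr (_ * _).
  by rewrite rmorphB /= horner_mx_X horner_mx_C homB homZ hom1 scalemx1.
have sg : star g = g.
  rewrite /g big_seq; apply: (star_prod HA) => z; rewrite mem_undup => zrs.
  rewrite (starD HA) (starN HA) (star_alg HA) sh; congr (_ - _%:A).
  have : eigenvalue (th h) z by rewrite eigenvalue_root_min -/p prs root_prod_XsubC.
  move=> /eigenvalueP[v vz v0]; have := eigenvalue_selfadjoint_real sh v0 vz.
  by case: (z) => a b /= ->; rewrite oppr0.
rewrite thg; apply: (@hom_selfadjoint_nilpotent _ (size rs) sg).
rewrite -thg -rmorphXn; apply/mxminpoly_minP; rewrite -/p prs.
suff H s : {subset s <= rs} -> \prod_(z <- s) ('X - z%:P) %| q ^+ size s by apply: H.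
elim: s => [|z s IH] srs; first by rewrite big_nil dvd1p.
rewrite big_cons exprS dvdp_mul ?IH // => [|w ws]; last by rewrite srs // inE ws orbT.
by rewrite dvdp_XsubCl root_prod_XsubC mem_undup srs ?mem_head.
Qed.

(** Simultaneous diagonalization applies to a finite list of matrices. Adding self-adjoint elements
    greedily must stop, as each one raises the dimension of the span. *)
Lemma hom_spanning_selfadjoint : exists2 hs : seq A,
  {in hs, forall h, star h = h} &
  forall h, star h = h -> th h \in <<map th hs>>%VS.
Proof.
have main k : (exists2 hs : seq A, {in hs, forall h, star h = h} &
    forall h, star h = h -> th h \in <<map th hs>>%VS) \/
  (exists2 hs : seq A, {in hs, forall h, star h = h} & (k <= \dim <<map th hs>>)%N).
  elim: k => [|k [IH|[hs shs khs]]]; [by right; exists [::] | by left|].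
  have [H|H] := pselect (forall h, star h = h -> th h \in <<map th hs>>%VS).
    by left; exists hs.
  right; move/existsNP: H => [h /not_implyP[sh hN]].
  exists (h :: hs) => [x|]; first by rewrite inE => /orP[/eqP->|/shs].
  apply: leq_ltn_trans khs _; rewrite /= span_cons ltn_neqAle.
  rewrite (dimvS (addvSr _ _)) andbT; apply/negP => /eqP E; apply: hN.
  have /eqP-> : (<<map th hs>> == <[th h]> + <<map th hs>>)%VS.
    by rewrite eqEdim addvSr E leqnn.
  by rewrite (subvP (addvSl _ _)) // memv_line.
have [//|[hs _]] := main (\dim (fullv : {vspace 'M[C]_n})).+1.
by rewrite ltnNge dimvS // subvf.
Qed.

Lemma selfadjoint_decomposition f : exists h k,
  [/\ star h = h, star k = k & f = h + (0 +i* 1)%C *: k].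
Proof.
exists ((2^-1)%:C%C *: (f + star f)), ((0 -i* 2^-1)%C *: (f - star f)).
split.
- by rewrite (starZ HA) conjc_real (starD HA) (starK HA) addrC.
- rewrite (starZ HA) (starD HA) (starN HA) (starK HA) -[in RHS]opprB scalerN -scaleNr.
  by congr (_ *: _); apply/eqP; rewrite eq_complex /= oppr0 !eqxx.
rewrite scalerA; have -> : (0 +i* 1)%C * (0 -i* 2^-1)%C = (2^-1)%:C%C :> C.
  by apply/eqP; rewrite eq_complex /=; apply/andP; split; apply/eqP; ring.
rewrite -scalerDr addrACA subrr addr0 scalerDr -scalerDl -rmorphD /=.
by rewrite (_ : 2^-1 + 2^-1 = 1 :> R) ?scale1r //; lra.
Qed.

Lemma hom_simultaneous_eigenbasis : exists2 P : 'M[C]_n, P \in unitmx &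
  forall f i, exists a, row i P *m th f = a *: row i P.
Proof.
have [hs shs spanhs] := hom_spanning_selfadjoint.
have [P Pu /allP Pdiag] : codiagonalizable (map th hs).
  apply/codiagonalizableP; split => [_ _ /mapP[f _ ->] /mapP[g _ ->]|_ /mapP[h /shs sh ->]].
    by case: th_hom => _ thM _; rewrite /comm_mx -!thM mulrC.
  exact: hom_selfadjoint_diagonalizable.
exists P => // f i.
suff H h : star h = h -> exists a, row i P *m th h = a *: row i P.
  have [h [k [/H[a ah] /H[b bk] ->]]] := selfadjoint_decomposition f.
  exists (a + (0 +i* 1)%C * b).
  by rewrite homD homZ mulmxDr -scalemxAr ah bk scalerA scalerDl.
move=> /spanhs hspan.
have [c ->] : exists c : 'I_(size (map th hs)) -> C,
    th h = \sum_j c j *: (map th hs)`_j.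
  exists (fun j => coord (in_tuple (map th hs)) j (th h)).
  exact: (@coord_span _ _ _ (in_tuple (map th hs))).
elim/big_ind: _ => [|M N [a aM] [b bN]|j _].
- by exists 0; rewrite mulmx0 scale0r.
- by exists (a + b); rewrite mulmxDr aM bN scalerDl.
have /Pdiag/diagonalizable_forPex[D /(simmxP Pu) PD] :
  (map th hs)`_j \in map th hs by rewrite mem_nth.
exists (c j * D ord0 i).
rewrite -scalemxAr -row_mul PD -scalerA; congr (_ *: _).
by apply/rowP => k; rewrite mul_diag_mx !mxE.
Qed.

End Homomorphism.

(** * Characters *)

Section Characters.
Variable R : realType.
Local Notation C := R[i].
Variables (A : comAlgType C) (nrm : A -> R) (star : A -> A).
Hypothesis HA : is_comm_unital_Cstar_algebra nrm star.
Implicit Types (f g h : A) (l z : C).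

Definition contractive_character (chi : A -> C) :=
  [/\ forall l f g, chi (l *: f + g) = l * chi f + chi g,
      forall f g, chi (f * g) = chi f * chi g,
      chi 1 = 1 & forall f, cabs (chi f) <= nrm f].

Section Decomposition.
Variable n' : nat.
Local Notation n := n'.+1.
Variable th : A -> 'M[C]_n.
Hypotheses (th_hom : is_unital_hom th) (th_cont : continuous_map nrm th).

(** The eigenvalue of [th f] on a fixed common eigenvector is unique, hence linear and
    multiplicative in [f]. The [E i] are the coordinate projections of the eigenbasis. *)
Lemma hom_rank_one_decomposition : exists chi (E : 'I_n -> 'M[C]_n),
  (forall i, contractive_character (chi i)) /\
  forall f, th f = \sum_i chi i f *: E i.
Proof.
have [P Pu Peig] := hom_simultaneous_eigenbasis HA th_hom th_cont.
have Prow i : row i P != 0.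
  apply/negP => /eqP Pi0; move: Pu; rewrite -row_free_unit => /row_free_inj Pinj.
  have := Pinj 1%N (delta_mx ord0 i) 0; rewrite /= -rowE Pi0 mul0mx => /(_ erefl).
  by move=> /(congr1 (fun v : 'rV[C]_n => v ord0 i)) /eqP; rewrite !mxE !eqxx oner_eq0.
have [chi chiP] := choice (fun p : A * 'I_n => Peig p.1 p.2).
have chi_uniq i a b : a *: row i P = b *: row i P -> a = b.
  move=> /eqP; rewrite -subr_eq0 -scalerBl scaler_eq0 (negPf (Prow i)) orbF.
  by rewrite subr_eq0 => /eqP.
exists (fun i f => chi (f, i)), (fun i => col i (invmx P) *m row i P); split.
  move=> i; split=> [l f g|f g||f].
  - apply: (chi_uniq i); rewrite -[LHS](chiP (_, i)) /= homP // mulmxDr -scalemxAr.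
    by rewrite (chiP (f, i)) (chiP (g, i)) scalerA scalerDl.
  - apply: (chi_uniq i); rewrite -[LHS](chiP (_, i)) /= homM // mulmxA.
    by rewrite (chiP (f, i)) -scalemxAl (chiP (g, i)) scalerA.
  - by apply: (chi_uniq i); rewrite -[LHS](chiP (_, i)) /= hom1 // mulmx1 scale1r.
  - exact: (eigenvalue_le_nrm HA th_hom th_cont (Prow i) (chiP (f, i))).
move=> f; rewrite -[LHS]mul1mx -(mulVmx Pu) -mulmxA; apply/matrixP => a b.
rewrite mxE summxE; apply: eq_bigr => i _.
have := congr1 (fun v : 'rV[C]_n => v ord0 b) (chiP (f, i)).
rewrite /= -row_mul !mxE => ->; rewrite (big_ord1) !mxE; ring.
Qed.

(* Averaging the coefficient matrices over the indices carrying the same character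
   replaces a list of distinct characters. *)
Lemma hom_character_decomposition : exists chi (Q : 'I_n -> 'M[C]_n),
  [/\ forall i, contractive_character (chi i),
      forall f, th f = \sum_i chi i f *: Q i &
      forall i j, (forall f, chi i f = chi j f) -> Q i = Q j].
Proof.
have [chi [E [chiP thE]]] := hom_rank_one_decomposition.
pose same i j := `[< forall f, chi i f = chi j f >].
have sameP i j : reflect (forall f, chi i f = chi j f) (same i j) by apply: asboolP.
have sameC i j : same i j = same j i.
  by apply/sameP/sameP => H f; rewrite H.
have sameE i j : same i j -> same i =1 same j.
  by move=> /sameP ij k; apply/sameP/sameP => H f; rewrite -H ?ij // -ij.
pose N i : C := (#|[pred k | same i k]|)%:R.
have N0 i : N i != 0.
  by rewrite pnatr_eq0 -lt0n; apply/card_gt0P; exists i; apply/(sameP i i).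
have NE i j : same i j -> N i = N j.
  by move=> /sameE ij; congr _%:R; apply: eq_card => k; rewrite !inE ij.
exists chi, (fun i => (N i)^-1 *: \sum_(k | same i k) E k); split=> // [f|i j ij].
  rewrite thE; under [RHS]eq_bigr => i _ do rewrite scalerA scaler_sumr big_mkcond.
  rewrite exchange_big /=; apply: eq_bigr => k _; rewrite -big_mkcond /=.
  rewrite (eq_bigr (fun _ => (chi k f / N k) *: E k)); last first.
    by move=> i ik; rewrite (NE _ _ ik); move/sameP: ik => ->.
  rewrite (eq_bigl (fun i => i \in [pred i | same k i])); last first.
    by move=> i; rewrite inE sameC.
  by rewrite sumr_const -scaler_nat scalerA mulrCA mulrV ?mulr1 ?unitfE ?N0.
have sij : same i j by apply/sameP.
by rewrite (NE _ _ sij); congr (_ *: _); apply: eq_bigl; apply: sameE.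
Qed.

End Decomposition.

(** * Interpolating indicators of sets of characters *)

Section Interpolation.
Variables (n : nat) (chi : 'I_n -> A -> C).
Hypothesis chiP : forall i, contractive_character (chi i).

Let chi_lin i l f g : chi i (l *: f + g) = l * chi i f + chi i g.
Proof. by case: (chiP i). Qed.

Let chiM i f g : chi i (f * g) = chi i f * chi i g.
Proof. by case: (chiP i). Qed.

Let chi1 i : chi i 1 = 1.
Proof. by case: (chiP i). Qed.

Let chi_le i f : cabs (chi i f) <= nrm f.
Proof. by case: (chiP i). Qed.

Let chiD i := functionalD (chi_lin i).
Let chiZ i := functionalZ (chi_lin i).

Lemma characterB i f g : chi i (f - g) = chi i f - chi i g.
Proof. by rewrite chiD -scaleN1r chiZ mulN1r. Qed.

Lemma character_real i h : star h = h -> conjc (chi i h) = chi i h.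
Proof.
move=> /(functional_selfadjoint_real HA (chi_lin i) (chi1 i) (chi_le i)).
by case: (chi i h) => a b /= ->; rewrite oppr0.
Qed.

Lemma character_star i f : chi i (star f) = conjc (chi i f).
Proof.
have [h [k [sh sk ->]]] := selfadjoint_decomposition HA f.
rewrite (starD HA) (starZ HA) sh sk !chiD !chiZ rmorphD rmorphM /=.
by rewrite !(character_real i sh) (character_real i sk).
Qed.

Lemma character_prod i (I : Type) (r : seq I) (P : pred I) (F : I -> A) :
  chi i (\prod_(k <- r | P k) F k) = \prod_(k <- r | P k) chi i (F k).
Proof. by apply: (big_morph (chi i)); [apply: chiM | apply: chi1]. Qed.

Lemma separating_selfadjoint i j : (exists f, chi i f != chi j f) ->
  exists s, [/\ star s = s, chi i s = 1 & chi j s = 0].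
Proof.
move=> [f fij]; have [h sh hij] : exists2 h, star h = h & chi i h != chi j h.
  have [h [k [sh sk fE]]] := selfadjoint_decomposition HA f.
  have [hE|] := eqVneq (chi i h) (chi j h); last by exists h.
  exists k => //; apply: contraNneq fij => kE.
  by rewrite fE !chiD !chiZ hE kE.
have d0 : chi i h - chi j h != 0 by rewrite subr_eq0.
exists ((chi i h - chi j h)^-1 *: (h - (chi j h)%:A)); split.
- rewrite (starZ HA) (starD HA) (starN HA) (star_alg HA) sh.
  by rewrite fmorphV rmorphB /= !(character_real _ sh).
- by rewrite chiZ characterB chiZ chi1 mulr1 mulVf.
- by rewrite chiZ characterB chiZ chi1 mulr1 subrr mulr0.
Qed.

(** A separator [s (i, j)] is controlled at [chi i] and [chi j] only. The nested product tolerates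
    this: at [k] in [K] the factor of index [k] vanishes, and at [k] outside [K] every inner product
    contains [s (i, k)], which is 0 there. *)
Lemma selfadjoint_indicator (K : {set 'I_n}) :
  (forall i j, i \in K -> j \notin K -> exists f, chi i f != chi j f) ->
  exists2 b, star b = b & forall i, chi i b = (i \in K)%:R.
Proof.
move=> Ksep.
(* The choice must be total; pairs not in [K] times its complement receive the self-adjoint filler
   1. *)
have /choice[s sP] : forall p : 'I_n * 'I_n, exists s, star s = s /\
    (p.1 \in K -> p.2 \notin K -> chi p.1 s = 1 /\ chi p.2 s = 0).
  move=> [i j] /=.
  have [iK|iK] := boolP (i \in K); last by exists 1; split=> //; rewrite (star1 HA).
  have [jK|jK] := boolP (j \in K); first by exists 1; split=> [|_ //]; rewrite (star1 HA).
  by have [s [? ? ?]] := separating_selfadjoint (Ksep _ _ iK jK); exists s.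
exists (1 - \prod_(i in K) (1 - \prod_(j in ~: K) s (i, j))).
  rewrite (starD HA) (starN HA) (star1 HA) (star_prod HA) // => i _.
  rewrite (starD HA) (starN HA) (star1 HA) (star_prod HA) // => j _.
  by case: (sP (i, j)).
move=> k; rewrite characterB chi1 character_prod.
have [kK|kK] := boolP (k \in K).
  rewrite (bigD1 k) //= characterB chi1 character_prod big1 ?subrr ?mul0r ?subr0 //.
  by move=> j; rewrite inE => jK; case: (sP (k, j)) => _ /(_ kK jK)[].
rewrite big1 ?subrr // => i iK; rewrite characterB chi1 character_prod.
rewrite (bigD1 k) ?inE //=; case: (sP (i, k)) => _ /(_ iK kK)[_ ->].
by rewrite mul0r subr0.
Qed.

(* With [r = 1 / (1 + b^2)], [x = 2 b r] and [y = (1 - b^2) r] satisfy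
   [x^2 + y^2 = 1], while [x] takes the values 0 and 1 where [b] does. *)
Lemma square_indicator (K : {set 'I_n}) :
  (forall i j, i \in K -> j \notin K -> exists f, chi i f != chi j f) ->
  exists x y, [/\ star x = x, star y = y, x * x + y * y = 1 &
    forall i, chi i (x * x) = (i \in K)%:R].
Proof.
move=> /selfadjoint_indicator[b sb bK].
have [r rb sr] := inverse_one_add_sqr HA sb.
exists ((b + b) * r), ((1 - b * b) * r); split.
- by rewrite (starM HA) (starD HA) sb sr.
- by rewrite (starM HA) (starD HA) (starN HA) (starM HA) (star1 HA) sb sr.
- have -> : (b + b) * r * ((b + b) * r) + (1 - b * b) * r * ((1 - b * b) * r) =
    (r * (1 + b * b)) * (r * (1 + b * b)) by ring.
  by rewrite rb mulr1.
move=> i; have := congr1 (chi i) rb.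
rewrite !chiM !chiD chi1 chiM bK; case: (_ \in _) => /=.
  by rewrite mulr1 mulrC => ->; rewrite mulr1.
by rewrite addr0 !mul0r.
Qed.

End Interpolation.

End Characters.

(** * Adjoints and positive forms *)

Section Adjoint.
Variables (R : realType) (n : nat).
Local Notation C := R[i].
Implicit Types (M N T S Q : 'M[C]_n) (v w : 'cV[C]_n) (l : C).

Definition dot v w : C := \sum_i conjc (v i ord0) * w i ord0.

Lemma dotDr v w w' : dot v (w + w') = dot v w + dot v w'.
Proof. by rewrite -big_split /=; apply: eq_bigr => i _; rewrite mxE mulrDr. Qed.

Lemma dotZr v l w : dot v (l *: w) = l * dot v w.
Proof. by rewrite mulr_sumr; apply: eq_bigr => i _; rewrite mxE mulrCA. Qed.

Lemma dotC v w : dot v w = conjc (dot w v).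
Proof.
rewrite rmorph_sum; apply: eq_bigr => i _.
by rewrite rmorphM /= conjcK mulrC.
Qed.

Lemma dotDl v v' w : dot (v + v') w = dot v w + dot v' w.
Proof. by rewrite dotC dotDr rmorphD /= -!dotC. Qed.

Lemma dotZl l v w : dot (l *: v) w = conjc l * dot v w.
Proof. by rewrite dotC dotZr rmorphM /= -dotC. Qed.

Lemma dot0r v : dot v 0 = 0.
Proof. by rewrite -(scale0r 0) dotZr mul0r. Qed.

Lemma dot_vnorm v : dot v v = ((vnorm v ^+ 2)%:C)%C.
Proof. by rewrite vnorm_sqr rmorph_sum; apply: eq_bigr => i _; rewrite -cabs_sqrJ. Qed.

Lemma dot_self_eq0 v : dot v v = 0 -> v = 0.
Proof.
by rewrite dot_vnorm => /complexI /eqP; rewrite sqrf_eq0 => /eqP/vnorm0_eq0.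
Qed.

Lemma cauchy_schwarz v w : cabs (dot v w) <= vnorm v * vnorm w.
Proof.
have unit (v' w' : 'cV[C]_n) : vnorm v' = 1 -> vnorm w' = 1 -> cabs (dot v' w') <= 1.
  move=> v1 w1; apply: le_trans (cabs_sum _ _ _) _.
  apply: le_trans (_ : \sum_i (cabs (v' i ord0) ^+ 2 + cabs (w' i ord0) ^+ 2) / 2 <= _).
    apply: ler_sum => i _; rewrite cabsM cabsJ.
    by have := sqr_ge0 (cabs (v' i ord0) - cabs (w' i ord0)); nra.
  by rewrite -mulr_suml big_split /= -!vnorm_sqr v1 w1; lra.
have normalize (u : 'cV[C]_n) : u = 0 \/ exists2 u', vnorm u' = 1 & u = (vnorm u)%:C%C *: u'.
  have [/vnorm0_eq0->|u0] := eqVneq (vnorm u) 0; [by left | right].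
  exists ((vnorm u)^-1%:C%C *: u).
    by rewrite vnormZ cabs_real ger0_norm ?invr_ge0 ?vnorm_ge0 // mulVf.
  by rewrite scalerA -rmorphM /= mulfV // scale1r.
have [->|[v' v1 vE]] := normalize v.
  by rewrite dotC dot0r conjc0 cabs0 mulr_ge0 ?vnorm_ge0.
have [->|[w' w1 wE]] := normalize w.
  by rewrite dot0r cabs0 mulr_ge0 ?vnorm_ge0.
rewrite vE wE dotZl dotZr !cabsM cabsJ -vE -wE !cabs_real !ger0_norm ?vnorm_ge0 //.
by rewrite mulrA ler_piMr ?mulr_ge0 ?vnorm_ge0 // unit.
Qed.

Lemma adjmxD M N : adjmx (M + N) = adjmx M + adjmx N.
Proof. by rewrite /adjmx linearD /= map_mxD. Qed.

Lemma adjmxZ l M : adjmx (l *: M) = conjc l *: adjmx M.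
Proof. by apply/matrixP => i j; rewrite !mxE rmorphM. Qed.

Lemma adjmxN M : adjmx (- M) = - adjmx M.
Proof. by apply/matrixP => i j; rewrite !mxE rmorphN. Qed.

Lemma adjmxM M N : adjmx (M *m N) = adjmx N *m adjmx M.
Proof. by rewrite /adjmx trmx_mul map_mxM. Qed.

Lemma adjmxK M : adjmx (adjmx M) = M.
Proof. by apply/matrixP => i j; rewrite !mxE conjcK. Qed.

Lemma adjmx1 : adjmx 1%:M = 1%:M :> 'M[C]_n.
Proof. by rewrite /adjmx trmx1 map_mx1. Qed.

Lemma adjmx_sum (I : Type) (r : seq I) (P : pred I) (F : I -> 'M[C]_n) :
  adjmx (\sum_(i <- r | P i) F i) = \sum_(i <- r | P i) adjmx (F i).
Proof.
apply: (big_morph (@adjmx R n)); first exact: adjmxD.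
by apply/matrixP => i j; rewrite !mxE conjc0.
Qed.

Lemma dot_mulmxl M v w : dot (M *m v) w = dot v (adjmx M *m w).
Proof.
rewrite /dot; under eq_bigr => i _ do rewrite mxE rmorph_sum mulr_suml.
rewrite exchange_big /=; apply: eq_bigr => j _; rewrite mxE mulr_sumr.
by apply: eq_bigr => i _; rewrite !mxE rmorphM /=; ring.
Qed.

Lemma dot_mulmxr M v w : dot v (M *m w) = dot (adjmx M *m v) w.
Proof. by rewrite dot_mulmxl adjmxK. Qed.

Lemma mulmx_cV_eq0 M : (forall v, M *m v = 0) -> M = 0.
Proof.
move=> M0; apply/matrixP => i j; rewrite [RHS]mxE.
by have := congr1 (fun u : 'cV[C]_n => u i ord0) (M0 (delta_mx j ord0)); rewrite -colE !mxE.
Qed.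

Lemma adjmx_mul_eq0 M : adjmx M *m M = 0 -> M = 0.
Proof.
move=> MM; apply: mulmx_cV_eq0 => v; apply: dot_self_eq0.
by rewrite dot_mulmxl mulmxA MM mul0mx dot0r.
Qed.

(** Polarization of the vanishing form of [adjmx M - M]: testing [v + w] and [v + i w] kills all its
    mixed terms. *)
Lemma selfadjoint_of_real_form M :
  (forall v, conjc (dot v (M *m v)) = dot v (M *m v)) -> adjmx M = M.
Proof.
move=> Mreal; pose H := adjmx M - M.
have H0 v : dot v (H *m v) = 0.
  rewrite mulmxBl -scaleN1r dotDr dotZr -dot_mulmxl dotC Mreal; ring.
have H1 v w : dot v (H *m w) = 0.
  have := H0 (v + w); have := H0 (v + (0 +i* 1)%C *: w).
  rewrite !mulmxDr -!scalemxAr !dotDr !dotDl !dotZr !dotZl !H0.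
  have -> : conjc (0 +i* 1)%C = - (0 +i* 1)%C :> C by simpc.
  set X := dot v _; set Y := dot w _.
  rewrite !mulr0 !add0r !addr0 => e1 e2.
  have i0 : (0 +i* 1)%C != 0 :> C by rewrite eq_complex /= oner_eq0 andbF.
  have : (0 +i* 1)%C * (X - Y) = 0 :> C by rewrite -e1; ring.
  move=> /eqP; rewrite mulf_eq0 (negPf i0) subr_eq0 /= => /eqP XY.
  move: e2; rewrite -XY -mulr2n => /eqP; rewrite mulrn_eq0 /= => /eqP//.
apply/eqP; rewrite -subr_eq0 -/H; apply/eqP/mulmx_cV_eq0 => v.
exact: dot_self_eq0.
Qed.

(** With [u = T *m v], the form at [v - t u] equals [- 2 t N + t^2 c], which is negative for small
    positive [t] unless [u] is 0. *)
Lemma psd_form_eq0 T v : (forall w, 0 <= dot w (T *m w)) -> adjmx T = T ->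
  dot v (T *m v) = 0 -> T *m v = 0.
Proof.
move=> T0 Tsa Tv; set u := T *m v; apply: vnorm0_eq0; apply/eqP/negPn/negP => u0.
have Np : 0 < vnorm u ^+ 2 by rewrite exprn_gt0 // lt_def u0 vnorm_ge0.
set N := vnorm u ^+ 2 in Np.
pose c := complex.Re (dot u (T *m u)).
have cE : dot u (T *m u) = c%:C%C.
  have := T0 u; rewrite /c; case: (dot _ _) => a b; rewrite lecE /= => /andP[/eqP-> _] //.
have c0 : 0 <= c by have := T0 u; rewrite cE ler0c.
pose t := N / (1 + c).
have tc : t * c < N.
  have -> : N = t * (1 + c) by rewrite divfK // gt_eqF //; lra.
  by have t0 : 0 < t by [rewrite divr_gt0 //; lra]; lra.
have t0 : 0 < t by rewrite divr_gt0 //; lra.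
have := T0 (v + (- t)%:C%C *: u).
rewrite mulmxDr -scalemxAr !dotDr !dotDl !dotZr !dotZl Tv -/u conjc_real cE.
rewrite (dot_mulmxr T v) Tsa -/u dot_vnorm -/N -!rmorphM /= add0r -!rmorphD /= ler0c.
nra.
Qed.

(* Test the form on [y = (Q^* - Q Q^* ) x], which [Q] and [S] annihilate: it
   vanishes there, so [Q^* y = 0]. *)
Lemma idempotent_selfadjoint Q S : Q *m Q = Q -> Q *m S = 0 -> S *m Q = 0 ->
  adjmx S = S -> (forall v, 0 <= dot v ((Q + adjmx Q + S) *m v)) -> adjmx Q = Q.
Proof.
move=> QQ QS SQ Ssa Tpos; set T := Q + _ + S in Tpos.
have Tsa : adjmx T = T by rewrite !adjmxD adjmxK Ssa [adjmx Q + Q]addrC.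
have aQQ : adjmx Q *m adjmx Q = adjmx Q by rewrite -adjmxM QQ.
pose Y := adjmx Q - Q *m adjmx Q.
have QY : Q *m Y = 0 by rewrite mulmxBr mulmxA QQ subrr.
have SY : S *m Y = 0.
  by rewrite mulmxBr mulmxA SQ mul0mx subr0 -Ssa -adjmxM QS /adjmx trmx0 map_mx0.
have TY : T *m Y = adjmx Q *m Y by rewrite !mulmxDl QY SY add0r addr0.
have {}TY : adjmx Q *m Y = 0.
  apply: mulmx_cV_eq0 => v; rewrite -TY -mulmxA; apply: psd_form_eq0 => //.
  by rewrite !mulmxA TY -!mulmxA -dot_mulmxl mulmxA QY mul0mx dotC dot0r conjc0.
have QE : Q = Q *m adjmx Q *m Q.
  have /eqP := TY; rewrite mulmxBr aQQ subr_eq0 => /eqP /(congr1 (@adjmx R n)).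
  by rewrite !adjmxM !adjmxK.
(* Now [Q] is a partial isometry, so all four terms of the product of this difference with its
   adjoint reduce to [adjmx Q *m Q] and cancel. *)
have /eqP : Q - adjmx Q *m Q = 0.
  apply: adjmx_mul_eq0; rewrite adjmxD adjmxN adjmxM adjmxK mulmxBl !mulmxBr.
  have -> : adjmx Q *m (adjmx Q *m Q) = adjmx Q *m Q by rewrite mulmxA aQQ.
  have -> : adjmx Q *m Q *m Q = adjmx Q *m Q by rewrite -mulmxA QQ.
  by rewrite -(mulmxA (adjmx Q)) (mulmxA Q) -QE !subrr.
rewrite subr_eq0 => /eqP QA; by rewrite [in LHS]QA adjmxM adjmxK -QA.
Qed.

End Adjoint.

(** * The symmetrized homomorphism *)

Section Symmetrization.
Variable R : realType.
Local Notation C := R[i].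
Variables (A : comAlgType C) (nrm : A -> R) (star : A -> A).
Hypothesis HA : is_comm_unital_Cstar_algebra nrm star.
Variables (n' : nat).
Local Notation n := n'.+1.
Variable th : A -> 'M[C]_n.
Hypotheses (th_hom : is_unital_hom th) (th_cont : continuous_map nrm th).
Implicit Types (f g h : A) (l z : C).

Section Contraction.
Variable al : A -> A.
Hypotheses (al_anti : antilinear al) (al_contr : forall f, nrm (al f) <= nrm f)
  (al1 : al 1 = 1) (Hnorm : map_norm nrm (theta_alpha th al) <= 1).

Let sym f := th f + adjmx (th (al f)).

(** [Hnorm] bounds a supremum, which says something about each element only once the set is known to
    be bounded; the entry bound from continuity supplies this. *)
Lemma theta_alpha_contraction f : nrm f <= 1 -> mxnorm (theta_alpha th al f) <= 1.
Proof.
move=> f1; apply: le_trans Hnorm; move: f f1.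
have [K K0 thK] := hom_bounded_entries HA th_hom th_cont.
apply: (@mxnorm_le_map_norm _ _ _ _ _ (n%:R * (n%:R * K))) => f f1.
apply: mxnorm_le_entries => // i j.
have thK1 g a b : nrm g <= 1 -> cabs (th g a b) <= K.
  by move=> g1; apply: le_trans (thK g a b) _; rewrite ler_piMr.
rewrite /theta_alpha !mxE cabsM.
have -> : cabs (2^-1 : C) = 2^-1.
  by rewrite -[2 : C](rmorph_nat (real_complex R)) -fmorphV cabs_real ger0_norm ?invr_ge0 ?ler0n.
have := cabsD (th f i j) (conjc (th (al f) j i)); rewrite cabsJ.
have := thK1 f i j f1; have := thK1 (al f) j i (le_trans (al_contr f) f1); lra.
Qed.

Lemma sym_sqr_psd h v : star h = h -> 0 <= dot v (sym (h * h) *m v).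
Proof.
move=> sh.
have half0 : 2^-1 != 0 :> C by rewrite invr_eq0 pnatr_eq0.
suff unit u : vnorm u = 1 -> 0 <= dot u (theta_alpha th al (h * h) *m u).
  have [/vnorm0_eq0->|v0] := eqVneq (vnorm v) 0; first by rewrite mulmx0 dot0r.
  pose u := (vnorm v)^-1%:C%C *: v.
  have u1 : vnorm u = 1.
    by rewrite vnormZ cabs_real ger0_norm ?invr_ge0 ?vnorm_ge0 // mulVf.
  have := unit u u1; rewrite /theta_alpha -/(sym _) -scalemxAl dotZr.
  rewrite pmulr_rge0 ?invr_gt0 ?ltr0n // /u -scalemxAr dotZr dotZl conjc_real.
  have vp : 0 < (vnorm v)^-1%:C%C :> C.
    by rewrite ltcR invr_gt0 lt_def v0 vnorm_ge0.
  by rewrite !pmulr_rge0.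
move=> u1; pose phi f := dot u (theta_alpha th al f *m u).
have phi_lin l f g : phi (l *: f + g) = l * phi f + phi g.
  rewrite /phi -dotZr -dotDr scalemxAl -mulmxDl /theta_alpha; congr (dot _ (_ *m _)).
  rewrite al_anti !(homP th_hom) adjmxD adjmxZ conjcK scalerA mulrC -scalerA -scalerDr.
  by congr (_ *: _); rewrite scalerDr addrACA.
have phi1 : phi 1 = 1.
  have th1 : th 1 = 1%:M by case: th_hom.
  rewrite /phi /theta_alpha al1 th1 adjmx1 -mulr2n -[X in _ *: X]scaler_nat.
  by rewrite scalerA mulVf ?pnatr_eq0 // scale1r mul1mx dot_vnorm u1 expr1n.
have phi_le1 f : nrm f <= 1 -> cabs (phi f) <= 1.
  move=> f1; apply: le_trans (cauchy_schwarz _ _) _; rewrite u1 mul1r.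
  apply: le_trans (vnorm_le_mxnorm _ _) (theta_alpha_contraction f1).
  by rewrite u1.
have phi_le f : cabs (phi f) <= nrm f.
  have [/(nrm_eq0 HA)->|f0] := eqVneq (nrm f) 0.
    by rewrite (functional0 phi_lin) cabs0 (nrm0 HA).
  have fp : 0 < nrm f by rewrite lt_def f0 (nrm_ge0 HA).
  have := phi_le1 ((nrm f)^-1%:C%C *: f).
  rewrite (nrmZ HA) (functionalZ phi_lin) cabsM cabs_real gtr0_norm ?invr_gt0 //.
  by rewrite mulVf // lexx => /(_ isT); rewrite mulrC ler_pdivrMr // mul1r.
rewrite -/(phi _) lecE /=.
have := functional_sqr_ge HA phi_lin phi1 phi_le sh.
rewrite (functional_selfadjoint_real HA phi_lin phi1 phi_le) ?(starM HA) ?sh // eqxx /=.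
by apply: le_trans; rewrite sqr_ge0.
Qed.

Lemma character_alpha_sqr chi h : contractive_character nrm chi -> star h = h ->
  0 <= chi (al (h * h)).
Proof.
move=> [chi_lin _ chi1 chi_le] sh; pose psi f := conjc (chi (al f)).
have psi_lin l f g : psi (l *: f + g) = l * psi f + psi g.
  by rewrite /psi al_anti chi_lin rmorphD rmorphM /= conjcK.
have psi1 : psi 1 = 1 by rewrite /psi al1 chi1 conjc1.
have psi_le f : cabs (psi f) <= nrm f.
  by rewrite cabsJ; apply: le_trans (chi_le _) _; apply: al_contr.
rewrite -conj_ge0 -/(psi _) lecE /=.
have := functional_sqr_ge HA psi_lin psi1 psi_le sh.
rewrite (functional_selfadjoint_real HA psi_lin psi1 psi_le) ?(starM HA) ?sh // eqxx /=.
by apply: le_trans; rewrite sqr_ge0.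
Qed.

Section Coefficients.
Variables (chi : 'I_n -> A -> C) (Q : 'I_n -> 'M[C]_n).
Hypotheses (chiP : forall i, contractive_character nrm (chi i))
  (thE : forall f, th f = \sum_i chi i f *: Q i)
  (Q_inj : forall i j, (forall f, chi i f = chi j f) -> Q i = Q j).

(** Real values pass through the adjoint, so the skew part is linear in them. This applies to both
    [e] and [al e]. *)
Lemma skew_part_real_combination f (w : 'I_n -> R) :
  (forall i, chi i f = (w i)%:C%C) ->
  th f - adjmx (th f) = \sum_i (w i)%:C%C *: (Q i - adjmx (Q i)).
Proof.
move=> fw; rewrite thE adjmx_sum -sumrB; apply: eq_bigr => i _.
by rewrite fw adjmxZ conjc_real scalerBr.
Qed.

(* Let [d i] be the left-hand side and [K = {i | 0 < d i}], and let [e] take the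
   values [0 <= e <= 1] and restrict to the indicator of [K]. Since [sym e] is
   self-adjoint, the vector [d] has the same pairing with [1_K] and with the
   values of [al e], which lie in [0, 1]; this forces those values to be 1 on [K].
   Then [th (al e) - th e] is orthogonal to the idempotent [th e]. *)
Lemma skew_coefficient_le0 (c : C) a b i :
  complex.Re (c * (Q i - adjmx (Q i)) a b) <= 0.
Proof.
pose d k := complex.Re (c * (Q k - adjmx (Q k)) a b); rewrite -/(d i).
pose K := [set k | 0 < d k].
have [x [y [sx sy xy1 chix]]] : exists x y, [/\ star x = x, star y = y,
    x * x + y * y = 1 & forall k, chi k (x * x) = (k \in K)%:R].
  (* Equal characters have equal coefficients [Q], hence equal [d], so [K] never splits a class of
     equal characters. *)
  apply: (square_indicator HA chiP) => j k; rewrite !inE => jK kK.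
  apply/not_existsP => jk; move: kK; rewrite -leNgt leNgt => /negP; apply.
  rewrite /d -(Q_inj (i := j)) // => f; apply/eqP/negPn/negP.
  by apply: jk.
set e := x * x in xy1 chix.
have chiB j f g : chi j (f - g) = chi j f - chi j g := characterB chiP j f g.
have chiM j f g : chi j (f * g) = chi j f * chi j g by case: (chiP j).
have chi1 j : chi j 1 = 1 by case: (chiP j).
pose g j := complex.Re (chi j (al e)).
have g0 j : 0 <= chi j (al e) by apply: character_alpha_sqr.
have chig j : chi j (al e) = (g j)%:C%C by rewrite RRe_real // ger0_real.
have alB : al (1 - e) = 1 - al e.
  have c1 : conjc (1 : C) = 1 := conjc1 R.
  by have := al_anti 1 (1 - e) e; rewrite scale1r subrK al1 c1 scale1r => H;
    apply/eqP; rewrite eq_sym subr_eq -H.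
(* The upper bound is positivity at [1 - e], which is the square of [y]. *)
have g01 j : 0 <= g j <= 1.
  rewrite -!lecR -chig g0 /=; have := character_alpha_sqr (chiP j) sy.
  have -> : y * y = 1 - e by rewrite -xy1; ring.
  by rewrite alB chiB chi1 subr_ge0.
have Tpos v : 0 <= dot v (sym e *m v) by apply: sym_sqr_psd.
have Tsa : adjmx (sym e) = sym e.
  apply: selfadjoint_of_real_form => v; have := Tpos v.
  by case: (dot _ _) => p q; rewrite lecE /= => /andP[/eqP-> _]; rewrite oppr0.
have chiK j : chi j e = ((j \in K)%:R : R)%:C%C by rewrite chix rmorph_nat.
have symE : adjmx (th e) + th (al e) = th e + adjmx (th (al e)).
  by rewrite -[RHS]Tsa adjmxD adjmxK.
have skewE : th e - adjmx (th e) = th (al e) - adjmx (th (al e)).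
  by apply/eqP; rewrite subr_eq addrAC [th (al e) + _]addrC symE addrK.
have pairing (w : 'I_n -> R) :
    complex.Re (c * (\sum_j (w j)%:C%C *: (Q j - adjmx (Q j))) a b) = \sum_j w j * d j.
  rewrite summxE mulr_sumr raddf_sum; apply: eq_bigr => j _.
  rewrite /d mxE mulrCA; case: (c * _) => p q /=; ring.
have sumE : \sum_j (j \in K)%:R * d j = \sum_j g j * d j.
  rewrite -!pairing -(skew_part_real_combination chiK).
  by rewrite -(skew_part_real_combination chig) skewE.
(* [K] was chosen by the sign of [d] so that both factors have the same sign; a zero sum then forces
   every term to vanish. *)
have terms0 j : true -> 0 <= ((j \in K)%:R - g j) * d j.
  move=> _; have /andP[gj0 gj1] := g01 j; rewrite inE.
  by case: ltP => dj /=; nra.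
have gK j : j \in K -> g j = 1.
  move=> jK; have : \sum_j ((j \in K)%:R - g j) * d j = 0.
    by under eq_bigr => k _ do rewrite mulrBl; rewrite sumrB sumE subrr.
  move=> /(psumr_eq0P terms0)/(_ j isT)/eqP; rewrite jK mulf_eq0 => /orP[|].
    by rewrite subr_eq0 => /eqP.
  by move: jK; rewrite inE => /gt_eqF->.
have th_eq f f' : (forall j, chi j f = chi j f') -> th f = th f'.
  by move=> ff'; rewrite !thE; apply: eq_bigr => j _; rewrite ff'.
have ee j : chi j (e * e) = chi j e.
  by rewrite chiM chix; case: (_ \in _); rewrite ?mulr1 ?mulr0.
have eae j : chi j (e * (al e - e)) = chi j 0.
  rewrite -[0](subrr (1 : A)) chiB subrr chiM chiB chig chiK.
  by have [/gK->|_] := boolP (j \in K); rewrite ?subrr ?mulr0 ?mul0r.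
have Qsa : adjmx (th e) = th e.
  (* By [symE], adding this matrix to [th e + adjmx (th e)] gives [sym e], which is positive. *)
  apply: (@idempotent_selfadjoint _ _ _ (th (al e) - th e)).
  - by rewrite -[LHS](homM th_hom); apply: th_eq.
  - by rewrite -(homB th_hom) -[LHS](homM th_hom) (th_eq _ 0) ?(hom0 th_hom).
  - by rewrite -(homB th_hom) -[LHS](homM th_hom) mulrC (th_eq _ 0) ?(hom0 th_hom).
  - rewrite adjmxD adjmxN; apply/eqP; rewrite subr_eq addrAC [th (al e) + _]addrC.
    by rewrite symE addrC addKr.
  - move=> v; have := Tpos v; congr (0 <= dot v (_ *m v)).
    by rewrite /sym -symE [th e + _]addrC -addrA [th e + _]addrC subrK.
(* The skew part of [th e] is now 0, so the numbers [d j] over [K], all positive, sum to 0; hence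
   [i] cannot lie in [K]. *)
rewrite leNgt; apply/negP => di.
have : \sum_j (j \in K)%:R * d j = 0.
  by rewrite -pairing -(skew_part_real_combination chiK) Qsa subrr mxE mulr0.
move=> /psumr_eq0P/(_ i isT)/eqP; rewrite inE di mul1r gt_eqF //= => H.
apply/notF/H => j _; rewrite inE; case: ltP => dj; rewrite ?mul1r ?mul0r //; exact: ltW.
Qed.

(** The one-sided bound holds for every [c]: using [c] and [- c] turns it into an equality, and
    [c = 1] and [c = i] read off the real and imaginary parts of each entry. *)
Lemma coefficient_selfadjoint i : adjmx (Q i) = Q i.
Proof.
have Re0 c a b : complex.Re (c * (Q i - adjmx (Q i)) a b) = 0.
  apply/eqP; rewrite eq_le skew_coefficient_le0 /= -oppr_le0.
  have := skew_coefficient_le0 (- c) a b i.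
  by rewrite mulNr; case: (c * _).
apply/esym/eqP; rewrite -subr_eq0; apply/eqP/matrixP => a b.
rewrite [RHS]mxE; have := Re0 1 a b; have := Re0 (0 +i* 1)%C a b.
case: (_ a b) => p q /=; rewrite !mul0r !mul1r sub0r subr0 => /eqP.
by rewrite oppr_eq0 => /eqP-> ->.
Qed.

End Coefficients.

Lemma symmetrized_contraction_star_hom : is_star_hom star th.
Proof.
have [chi [Q [chiP thE Q_inj]]] := hom_character_decomposition HA th_hom th_cont.
split=> // f; rewrite !thE adjmx_sum; apply: eq_bigr => i _.
by rewrite adjmxZ (coefficient_selfadjoint chiP thE Q_inj) (character_star HA chiP).
Qed.

End Contraction.

(** * Norm of a star-homomorphism *)

Section StarHomomorphism.
Hypothesis th_star : forall f, th (star f) = adjmx (th f).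

Lemma vnorm_star_hom_sqr_le f v :
  vnorm (th f *m v) ^+ 2 <= vnorm v * vnorm (th (star f * f) *m v).
Proof.
apply: le_trans (cauchy_schwarz _ _).
rewrite -[leLHS]ger0_norm ?sqr_ge0 // -cabs_real -dot_vnorm dot_mulmxl -th_star.
by rewrite mulmxA (homM th_hom).
Qed.

(** For self-adjoint [h] and unit [v], repeated squaring moves the exponent [2 ^ k] inside [th],
    where the crude entry bound applies, and roots remove its constant. The general case passes
    through [star f * f]. *)
Lemma mxnorm_star_hom_le f : mxnorm (th f) <= nrm f.
Proof.
have [K K0 thK] := hom_bounded_entries HA th_hom th_cont.
suff unit v : vnorm v = 1 -> vnorm (th f *m v) <= nrm f.
  apply: mxnorm_le => v v1.
  have [/vnorm0_eq0->|v0] := eqVneq (vnorm v) 0.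
    by rewrite mulmx0 vnorm0 (nrm_ge0 HA).
  have := unit ((vnorm v)^-1%:C%C *: v).
  rewrite -scalemxAr !vnormZ cabs_real ger0_norm ?invr_ge0 ?vnorm_ge0 // mulVf //.
  move=> /(_ erefl); rewrite mulrC ler_pdivrMr ?lt_def ?v0 ?vnorm_ge0 // => H.
  by apply: le_trans H _; rewrite ler_piMr ?(nrm_ge0 HA).
move=> v1.
have sqr_le g : vnorm (th g *m v) ^+ 2 <= vnorm (th (star g * g) *m v).
  by have := vnorm_star_hom_sqr_le g v; rewrite v1 mul1r.
have sa_le h : star h = h -> vnorm (th h *m v) <= nrm h.
  move=> sh; apply: (@le_of_exp_le _ _ _ (n%:R * (n%:R * K))).
  - exact: vnorm_ge0.
  - exact: nrm_ge0 HA _.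
  move=> k; exists (2 ^ k)%N; first exact: ltnW (ltn_expl _ _).
  apply: le_trans (_ : vnorm (th (h ^+ (2 ^ k)) *m v) <= _).
    elim: k => [|k IH]; first by rewrite expn0 !expr1.
    rewrite expnS mulnC exprM; apply: le_trans (lerXn2r 2 _ _ IH) _;
      rewrite ?nnegrE ?exprn_ge0 ?vnorm_ge0 //.
    by apply: le_trans (sqr_le _) _; rewrite (starX HA) sh -expr2 -exprM.
  apply: le_trans (_ : n%:R * (n%:R * (K * nrm (h ^+ (2 ^ k)))) * vnorm v <= _).
    apply: vnorm_mulmx_le => [|i j]; last exact: thK.
    by rewrite mulr_ge0 ?(nrm_ge0 HA).
  by rewrite v1 mulr1 -!mulrA !ler_wpM2l ?ler0n // (nrmX HA).
rewrite -(@ler_pXn2r _ 2) ?nnegrE ?vnorm_ge0 ?(nrm_ge0 HA) //.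
apply: le_trans (sqr_le f) _; rewrite -(nrm_starM HA); apply: sa_le.
by rewrite (starM HA) (starK HA) mulrC.
Qed.

Lemma map_norm_star_hom : map_norm nrm th = 1.
Proof.
apply/eqP; rewrite eq_le; apply/andP; split.
  apply: ge_sup; last by move=> _ [f /= f1 <-]; apply: le_trans (mxnorm_star_hom_le f) f1.
  by exists (mxnorm (th 0)), 0 => //=; rewrite (nrm0 HA).
(* The lower bound reads a diagonal entry of the identity, which exists because the size is
   positive. *)
apply: le_trans (_ : mxnorm (th 1) <= _).
  by rewrite (hom1 th_hom); apply: le_trans (cabs_le_mxnorm _ ord0 ord0); rewrite mxE cabs1.
apply: (@mxnorm_le_map_norm _ _ _ _ _ 1); last exact: nrm1_le1 HA.
by move=> f f1; apply: le_trans (mxnorm_star_hom_le f) f1.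
Qed.

End StarHomomorphism.

End Symmetrization.

Theorem theorem1p5 (R : realType) (A : comAlgType R[i])
    (nrm : A -> R) (star : A -> A)
    (HA : is_comm_unital_Cstar_algebra nrm star)
    (n : nat) (hn : (0 < n)%N)
    (th : A -> 'M[R[i]]_n)
    (Hth_hom : is_unital_hom th) (Hth_cont : continuous_map nrm th)
    (al : A -> A)
    (Hal_anti : antilinear al)
    (Hal_contr : forall f : A, nrm (al f) <= nrm f)
    (Hal_unit : al 1 = 1)
    (Hnorm : map_norm nrm (theta_alpha th al) <= 1) :
  is_star_hom star th /\ map_norm nrm th = 1.
Proof.
case: n hn th Hth_hom Hth_cont Hnorm => // n' _ th th_hom th_cont Hnorm.
have th_star := symmetrized_contraction_star_hom HA th_hom th_cont
  Hal_anti Hal_contr Hal_unit Hnorm.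
by split=> //; case: th_star => _; apply: map_norm_star_hom.
Qed.
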